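(* For all integers $a$, $b$ and $n$, the following are equivalent: (i) there exists a class $\mathcal H$ (over some domain) with $\mathtt{VC}(\mathcal H)\le a$, $\mathtt{VC}^{*\mathrm a}(\mathcal H)\le b$ and $\mathtt{sd}_{\mathrm{simp}}(\mathcal H)\ge n$; (ii) there exists a class $\mathcal D$ over the domain $\mathbb S^n$ that disambiguates $\mathbb S^n$ and satisfies $\mathtt{VC}(\mathcal D)\le a$ and $\mathtt{VC}^{*\mathrm a}(\mathcal D)\le b$.
   Context: A class $\mathcal H$ over a domain $X$ is a nonempty set of functions $h:X\to\{-,+\}$; for $X'\subseteq X$, $\mathcal H|_{X'}=\{h|_{X'}:h\in\mathcal H\}$. For $X$ finite, let $\Delta(\mathcal H)$ be the simplicial complex with vertex set $X\times\{-,+\}$ whose simplices are the sets $F\subseteq X\times\{-,+\}$ such that some $h\in\mathcal H$ satisfies $h(x)=y$ for all $(x,y)\in F$ (geometrically: the space of distributions on $X\times\{-,+\}$ realizable by $\mathcal H$). For $F\subseteq X\times\{-,+\}$ put $-F=\{(x,-y):(x,y)\in F\}$; $\Delta^{\mathrm{ant}}(\mathcal H)$ is the subcomplex of simplices $F$ such that $-F$ is also a simplex, with the involution $(x,y)\mapsto(x,-y)$ on vertices. A simplicial $n$-sphere is a finite simplicial complex $Q$ with an involution $\nu$ of its vertex set mapping simplices to simplices, such that no simplex contains both $v$ and $\nu(v)$, and such that $(\|Q\|,\nu)$ ($\nu$ extended linearly to the geometric realization) is equivariantly homeomorphic to $(\mathbb S^n,v\mapsto-v)$. $\mathcal H$ admits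 a simplicial $n$-sphere if for some finite $X'\subseteq X$ there are a simplicial $n$-sphere $(Q,\nu)$ and a simplicial map $\beta$ from $Q$ to $\Delta^{\mathrm{ant}}(\mathcal H|_{X'})$ with $\beta(\nu(v))=-\beta(v)$ for every vertex $v$. $\mathtt{sd}_{\mathrm{simp}}(\mathcal H)$ is the maximal $n$ for which $\mathcal H$ admits a simplicial $n$-sphere ($\infty$ if unbounded, $-1$ if none). A set $S\subseteq X$ is shattered by $\mathcal H$ if every $s:S\to\{-,+\}$ equals $h|_S$ for some $h\in\mathcal H$; $\mathtt{VC}(\mathcal H)$ is the largest size of a shattered set. A set $H\subseteq\mathcal H$ is dually antipodally shattered if for every $r:H\to\{-,+\}$ there is $x\in X$ with either $h(x)=r(h)$ for all $h\in H$, or $h(x)=-r(h)$ for all $h\in H$; $\mathtt{VC}^{*\mathrm a}(\mathcal H)$ is the largest size of such $H$. $\mathbb S^n\subseteq\mathbb R^{n+1}$ is the unit sphere with geodesic (angular) distance $d$. A class $\mathcal D$ over $\mathbb S^n$ disambiguates $\mathbb S^n$ if there is $\varepsilon>0$ such that for every $u\in\mathbb S^n$ there is $h\in\mathcal D$ with $h(v)=+$ for all $v$ with $d(u,v)\le\varepsilon$ and $h(v)=-$ for all $v$ with $d(-u,v)\le\varepsilon$ (i.e. $\mathcal D$ extends every partial function of the class of linear classifiers with margin parameter $\varepsilon$). *)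

(* Defs.v *)
From HB Require Import structures.
From mathcomp Require Import all_boot all_order all_algebra.
From mathcomp Require Import all_classical all_reals all_analysis.

Set Implicit Arguments.
Unset Strict Implicit.
Unset Printing Implicit Defensive.

Import Order.TTheory GRing.Theory Num.Theory.
Import numFieldNormedType.Exports.

Local Open Scope classical_set_scope.
Local Open Scope ring_scope.

(* The labels {-, +} are bool, with true for + and false for -, so that the
   sign change is negb. A class over X is a nonempty H : set (X -> bool);
   nonemptiness is assumed separately. *)

(* Suprema are taken in \bar R: +oo if the sizes are unbounded, -oo if there
   is no such set (the latter happens for VCa only, and only if X is empty). *)

Definition shattered (X : Type) (H : set (X -> bool)) (S : set X) : Prop :=
  forall s : X -> bool, exists2 h, H h & forall x, S x -> h x = s x.

Definition VC (R : realType) (X : Type) (H : set (X -> bool)) : \bar R :=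
  ereal_sup [set k%:R%:E | k in
    [set k : nat | exists2 S : set X, shattered H S & (S #= `I_k)%card]].

Definition dually_antipodally_shattered (X : Type) (G : set (X -> bool)) :
    Prop :=
  forall r : (X -> bool) -> bool, exists x : X,
    (forall h, G h -> h x = r h) \/ (forall h, G h -> h x = ~~ r h).

Definition VCa (R : realType) (X : Type) (H : set (X -> bool)) : \bar R :=
  ereal_sup [set k%:R%:E | k in
    [set k : nat | exists2 G : set (X -> bool),
       G `<=` H /\ dually_antipodally_shattered G & (G #= `I_k)%card]].

Definition restriction (X : Type) (H : set (X -> bool)) (X' : set X) :
    set (X' -> bool) :=
  [set (fun x : X' => h (val x)) | h in H].
Arguments restriction [X] H X'.

(* A complex on the vertex type V is the family of its simplices. *)
Definition Delta (X : Type) (H : set (X -> bool)) : set (set (X * bool)) :=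
  [set F | exists2 h, H h & forall xy, F xy -> h xy.1 = xy.2].

Definition antipode (X : Type) (xy : X * bool) : X * bool := (xy.1, ~~ xy.2).

Definition Delta_ant (X : Type) (H : set (X -> bool)) : set (set (X * bool)) :=
  [set F | Delta H F /\ Delta H (@antipode X @` F)].

Definition is_simplicial_complex (V : Type) (Q : set (set V)) : Prop :=
  (forall v, Q [set v]) /\ (forall F G, F `<=` G -> Q G -> Q F).

Definition simplicial_map (V W : Type) (Q : set (set V)) (L : set (set W))
    (beta : V -> W) : Prop :=
  forall F, Q F -> L (beta @` F).

Definition realization (R : realType) (V : finType) (Q : set (set V)) :
    set (prod_topology (fun _ : V => R)) :=
  [set p | [/\ forall v, 0 <= p v, \sum_v p v = 1 & Q [set v | p v != 0]]].

Definition linear_extension (R : realType) (V : finType) (nu : V -> V)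
    (p : prod_topology (fun _ : V => R)) :
    prod_topology (fun _ : V => R) :=
  fun v => \sum_(w | nu w == v) p w.

Definition dot (R : realType) (m : nat) (u v : 'rV[R]_m) : R :=
  \sum_i u 0 i * v 0 i.

(* The unit sphere of R^m, of dimension m - 1. *)
Definition unit_sphere (R : realType) (m : nat) : set 'rV[R]_m :=
  [set u | dot u u = 1].
Arguments unit_sphere R m : clear implicits.

Definition geodesic_dist (R : realType) (m : nat) (u v : 'rV[R]_m) : R :=
  acos (dot u v).

Definition homeomorphism (T U : topologicalType) (A : set T) (B : set U)
    (f : T -> U) : Prop :=
  exists g : U -> T,
    [/\ set_fun A B f, set_fun B A g,
        {within A, continuous f}, {within B, continuous g}
      & (forall x, A x -> g (f x) = x) /\ (forall y, B y -> f (g y) = y)].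

Definition is_simplicial_sphere (R : realType) (n : nat) (V : finType)
    (Q : set (set V)) (nu : V -> V) : Prop :=
  [/\ is_simplicial_complex Q,
      involutive nu,
      simplicial_map Q Q nu,
      forall F v, Q F -> ~ (F v /\ F (nu v))
    & exists2 f : prod_topology (fun _ : V => R) -> 'rV[R]_n.+1,
        homeomorphism (realization Q) (unit_sphere R n.+1) f
      & forall p, realization Q p -> f (linear_extension nu p) = - f p].

Definition admits_simplicial_sphere (R : realType) (X : Type)
    (H : set (X -> bool)) (n : nat) : Prop :=
  exists2 X' : set X, finite_set X' &
  exists (V : finType) (Q : set (set V)) (nu : V -> V) (beta : V -> X' * bool),
    [/\ is_simplicial_sphere R n Q nu,
        simplicial_map Q (Delta_ant (restriction H X')) beta
      & forall v, beta (nu v) = antipode (beta v)].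

Definition sd_simp (R : realType) (X : Type) (H : set (X -> bool)) : \bar R :=
  ereal_sup ([set (-1)%:E] `|`
    [set n%:R%:E | n in [set n : nat | admits_simplicial_sphere R H n]]).

(* S^n for an integer n, as a type. The ambient space R^(n+1) is taken to be
   R^0 for n < 0, in which case S^n is empty. *)
Definition ambient_dim (n : int) : nat := if n is Posz k then k.+1 else 0%N.

Definition Sphere (R : realType) (n : int) : Type :=
  set_type (unit_sphere R (ambient_dim n)).

Definition disambiguates (R : realType) (n : int)
    (D : set (Sphere R n -> bool)) : Prop :=
  exists2 eps : R, 0 < eps &
  forall u : Sphere R n, exists2 h, D h &
  forall v : Sphere R n,
    (geodesic_dist (val u) (val v) <= eps -> h v = true) /\
    (geodesic_dist (- val u) (val v) <= eps -> h v = false).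

(* Main.v *)
(* The VC-dimensions do not increase when a class is pulled back along a map
   from a new domain Y to labelled points (x, y) of the old domain X. So, for
   (i) => (ii), given a simplicial sphere Q with its map beta to Delta_ant,
   it suffices to send a point of the sphere to beta w, where w is a vertex
   of Q whose barycentric coordinate at that point is largest. If v is close
   to u, compactness gives that w lies in the carrier simplex of u, and a
   hypothesis realizing the beta-image of this simplex is correct near u and
   -u. A sphere of dimension m >= n contains S^n as a subsphere.

   For (ii) => (i), the class D itself admits S^n: take X' to be the vertices
   of a fine antipodal triangulation, and let beta send one vertex v of each
   antipodal pair to (v, +) and the other one to (v, -). The triangulation is
   the radial projection of the Freudenthal-Kuhn triangulation of the
   boundary of the cube [-N, N]^(n+1): its simplices are the chains of
   lattice points, on a common facet, that differ pairwise by a vector in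
   {0,1}^(n+1) or its opposite. *)
Require Import Defs.
From mathcomp Require Import all_boot all_order all_algebra.
From mathcomp Require Import all_classical all_reals all_analysis.
From mathcomp Require Import lra zify.

Set Implicit Arguments.
Unset Strict Implicit.
Unset Printing Implicit Defensive.

Import Order.TTheory GRing.Theory Num.Theory.
Import numFieldNormedType.Exports.

Local Open Scope classical_set_scope.
Local Open Scope ring_scope.

(** * Pulling a class back along a map to labelled points *)

Definition pullback (X Y : Type) (c : Y -> X * bool) (H : set (X -> bool)) :
    set (Y -> bool) :=
  [set (fun v => h (c v).1 == (c v).2) | h in H].

(** Flipping labels at fixed points permutes the patterns on [S], so every pattern still occurs
    downstairs. Two points of [S] with the same image in [X] would have labels that determine each
    other, which shattering excludes. *)
Lemma shattered_pullback (X Y : Type) (c : Y -> X * bool)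
    (H : set (X -> bool)) (S : set Y) :
  shattered (pullback c H) S ->
  shattered H ((fun v => (c v).1) @` S) /\
  ((fun v => (c v).1) @` S #= S)%card.
Proof.
move=> sh; split.
  move=> s; have [_ [h Hh <-] hs] := sh (fun u => s (c u).1 == (c u).2).
  exists h => // _ [v Sv <-]; have := hs v Sv.
  by case: (h _) (s _) (c v).2 => [] [] [].
apply: inj_card_eq => v v' /set_mem Sv /set_mem Sv' cvv'.
apply: contrapT => vv'.
(* This pattern forces [h] to be + at the common image because of [v], and - because of [v']. *)
have [_ [h _ <-] hs] := sh (fun u => if `[< u = v >] then (c u).2 else ~~ (c
  u).2).
have := hs v Sv; rewrite asboolT// => h1.
have := hs v' Sv'; rewrite asboolF; last by move=> e; apply: vv'.
rewrite -cvv'; move: h1.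
by case: (h _) (c v).2 (c v').2 => [] [] [].
Qed.

Lemma VC_pullback (R : realType) (X Y : Type) (c : Y -> X * bool)
    (H : set (X -> bool)) : (VC R (pullback c H) <= VC R H)%E.
Proof.
apply: ereal_sup_le => _ [k [S /shattered_pullback[sh cS] Sk] <-].
by exists k => //; exists ((fun v => (c v).1) @` S) => //;
  exact: card_eq_trans Sk.
Qed.

(** A label [(c v).2] flips the values of all hypotheses at the point simultaneously, and antipodal
    shattering allows exactly such a global flip. Choosing one preimage [l d] of each [d] in [G]
    therefore gives a shattered set of the same size. *)
Lemma VCa_pullback (R : realType) (X Y : Type) (c : Y -> X * bool)
    (H : set (X -> bool)) : (VCa R (pullback c H) <= VCa R H)%E.
Proof.
apply: ereal_sup_le => _ [k [G [GD shG] Gk] <-].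
pose pull (h : X -> bool) v := h (c v).1 == (c v).2.
have /choice[l lP] : forall d, exists h, G d -> H h /\ pull h = d.
  move=> d; have [/GD[h Hh hd]|Gd] := pselect (G d); first by exists h.
  by exists (fun=> true).
exists k => //; exists (l @` G); last first.
  apply: card_eq_trans Gk; apply: inj_card_eq => d d' /set_mem Gd /set_mem Gd'
    e.
  by rewrite -(lP d Gd).2 -(lP d' Gd').2 e.
split=> [_ [d /lP[+ _] <-]//|r].
have [v hv] := shG (fun d => r (l d)).
have E d : G d -> (l d (c v).1 == (c v).2) = d v by move=> Gd;
  rewrite -[in RHS](lP d Gd).2.
exists (c v).1; case cv: (c v).2 E hv => E [] hv; [left|right|right|left];
  move=> _ [d Gd <-]; move: (E d Gd); rewrite (hv d Gd);
  by case: (l d _) (r _) => [] [].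
Qed.

(** * Dot products and angular distance on the sphere *)

Section sphere_geometry.
Variable R : realType.

Lemma dotC m (u v : 'rV[R]_m) : dot u v = dot v u.
Proof. by apply: eq_bigr => i _; rewrite mulrC. Qed.

Lemma dotDl m (u v w : 'rV[R]_m) : dot (u + v) w = dot u w + dot v w.
Proof. by rewrite -big_split; apply: eq_bigr => i _; rewrite mxE mulrDl. Qed.

Lemma dotNl m (u v : 'rV[R]_m) : dot (- u) v = - dot u v.
Proof. by rewrite -sumrN; apply: eq_bigr => i _; rewrite mxE mulNr. Qed.

Lemma dotZl m a (u v : 'rV[R]_m) : dot (a *: u) v = a * dot u v.
Proof. by rewrite mulr_sumr; apply: eq_bigr => i _; rewrite mxE mulrA. Qed.

Lemma dotDr m (u v w : 'rV[R]_m) : dot u (v + w) = dot u v + dot u w.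
Proof. by rewrite dotC dotDl !(dotC u). Qed.

Lemma dotNr m (u v : 'rV[R]_m) : dot u (- v) = - dot u v.
Proof. by rewrite dotC dotNl dotC. Qed.

Lemma dotZr m a (u v : 'rV[R]_m) : dot u (a *: v) = a * dot u v.
Proof. by rewrite dotC dotZl dotC. Qed.

Lemma dot_ge0 m (u : 'rV[R]_m) : 0 <= dot u u.
Proof. by apply: sumr_ge0 => i _; rewrite -expr2 sqr_ge0. Qed.

Lemma dot_eq0 m (u : 'rV[R]_m) : dot u u = 0 -> u = 0.
Proof.
move/psumr_eq0P => h; apply/rowP => i; rewrite mxE; apply/eqP.
by rewrite -sqrf_eq0 expr2 h// => j _; rewrite -expr2 sqr_ge0.
Qed.

Lemma dot_unit_sphere m (u v : 'rV[R]_m) :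
  unit_sphere R m u -> unit_sphere R m v -> -1 <= dot u v <= 1.
Proof.
move=> uu vv; have := dot_ge0 (u + v); have := dot_ge0 (u - v).
rewrite !dotDl !dotDr !dotNl !dotNr uu vv (dotC v u) => *; lra.
Qed.

Lemma dot_unit_sphere_eq1 m (u v : 'rV[R]_m) :
  unit_sphere R m u -> unit_sphere R m v -> dot u v = 1 -> u = v.
Proof.
move=> uu vv uv; apply/eqP; rewrite -subr_eq0; apply/eqP/dot_eq0.
by rewrite dotDl !dotDr !dotNl !dotNr uu vv (dotC v u) uv; lra.
Qed.

Lemma geodesic_dist_le m (u v : 'rV[R]_m) (eps : R) :
  unit_sphere R m u -> unit_sphere R m v -> 0 <= eps <= pi ->
  (geodesic_dist u v <= eps) = (cos eps <= dot u v).
Proof.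
move=> uu vv epi; have uv := dot_unit_sphere uu vv.
rewrite -[in RHS](@acosK R (dot u v)) ?in_itv//=.
by rewrite [RHS]leNgt ltr_cos ?in_itv/= ?acos_ge0 ?acos_lepi// -leNgt.
Qed.

End sphere_geometry.

(* [t0] is the junk value of the inverse outside of [B]. *)
Lemma compact_bij_homeomorphism (T U : topologicalType) (t0 : T)
    (A : set T) (B : set U) (f : T -> U) :
  hausdorff_space U -> compact A -> {within A, continuous f} ->
  set_bij A B f -> homeomorphism A B f.
Proof.
move=> hU cA cf [fAB finj fsurj].
pose g y := xget t0 [set x | A x /\ f x = y].
have gP y : B y -> A (g y) /\ f (g y) = y.
  move=> /fsurj[x Ax xy]; rewrite /g; case: xgetP => [_ -> //|/(_ x)].
  by case.
have gK x : A x -> g (f x) = x.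
  move=> Ax; have [Agx fgx] := gP _ (fAB x Ax).
  by apply: finj; rewrite ?inE.
exists g; split=> //; first by move=> y /gP[].
  (* Within [B], the preimage of a closed [C] under [g] is the image of the compact set [A]
     intersected with [C], hence closed. *)
  apply/continuous_closedP => C cC; apply/closed_subspaceP.
  exists (f @` (A `&` C)).
    apply: compact_closed => //; apply: continuous_compact.
      by apply: continuous_subspaceW cf; exact: subIsetl.
    exact: compact_closedI.
  apply/seteqP; split=> [y [[x [Ax Cx] <-] Bfx]|y [/= Cgy By]].
    by split=> //; move: Cx; rewrite -{1}(gK x Ax).
  by split=> //; exists (g y) => //; [split=> //;
    case: (gP y By)|case: (gP y By)].
by split=> // y /gP[].
Qed.

(** * Compactness of geometric realizations *)

Section realization.
Variables (R : realType) (V : finType) (Q : set (set V)).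
Hypothesis cQ : is_simplicial_complex Q.

Local Notation RV := (prod_topology (fun _ : V => R)).

Lemma continuous_coord (v : V) : continuous (fun p : RV => p v).
Proof. exact: (@proj_continuous V (fun=> R) v). Qed.

Lemma closed_realization : closed (realization Q : set RV).
Proof.
move=> p clp; split.
- move=> v.
  suff : closed [set q : RV | 0 <= q v].
    by move/(_ p); apply; apply: closureS clp => q [q0 q1 _]; rewrite /= ?q1.
  apply: (@preimage_closed _ _ (fun q : RV => q v) [set x | 0 <= x]);
    last exact: closed_ge.
  by move=> q _; exact: continuous_coord.
- suff : closed [set q : RV | \sum_v q v = 1].
    by move/(_ p); apply; apply: closureS clp => q [q0 q1 _]; rewrite /= ?q1.
  apply: (@preimage_closed _ _ (fun q : RV => \sum_v q v) [set x | x = 1]);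
    last exact: closed_eq.
  by move=> q _; apply: continuous_big => [|v _];
    [exact: add_continuous|exact: continuous_coord].
(* Supports can only grow near [p], so the support of a limit point is a face of the support of some
   point of the realization. *)
- have : \forall q \near p, forall v, p v != 0 -> q v != 0.
    apply: (@filter_forall _ V (fun v (q : RV) => p v != 0 -> q v != 0)
      (nbhs (p : RV)) (nbhs_filter p)) => v.
    have [pv0|pv] := eqVneq (p v) 0; first exact: nearW.
    have : \forall x \near p v, x != 0 by apply: open_nbhs_nbhs; split=> //;
      exact: open_neq.
    move=> np.
    have vp : nbhs (p : RV) ((fun q : RV => q v) @^-1` [set x | x != 0]).
      exact: (@continuous_coord v p _ np).
    exact: (@filterS _ _ (nbhs_filter (p : RV)) _ _ (fun q qv _ => qv) vp).
  move=> /clp[q [[_ _ Qq] pq]]; apply: cQ.2 Qq => v; exact: pq.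
Qed.

Lemma compact_realization : compact (realization Q : set RV).
Proof.
pose cube : set RV := [set p | forall v : V, [set` `[0 : R, 1]] (p v)].
apply: (@subclosed_compact _ _ cube closed_realization).
  exact: (@tychonoff V (fun=> R) (fun=> [set` `[0 : R, 1]])
    (fun=> @segment_compact R 0 1)).
move=> p [p0 p1 _] v /=; rewrite in_itv/= p0 -p1 (bigD1 v)//= lerDl.
exact: sumr_ge0.
Qed.

Lemma realization_homeomorphism m (f : RV -> 'rV[R]_m) :
  {within realization Q, continuous f} ->
  set_bij (realization Q) (unit_sphere R m) f ->
  homeomorphism (realization Q) (unit_sphere R m) f.
Proof.
move=> cf fbij.
exact (@compact_bij_homeomorphism RV 'rV[R]_m (fun=> 0) _ _ f
  (@norm_hausdorff _ _) compact_realization cf fbij).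
Qed.

End realization.

(** * From a simplicial sphere to a disambiguation *)

Lemma cvg_dot (R : realType) (T : Type) (F : set_system T) (m : nat)
    (u v : T -> 'rV[R]_m) (a b : 'rV[R]_m) : Filter F ->
  u @ F --> a -> v @ F --> b -> dot (u x) (v x) @[x --> F] --> dot a b.
Proof.
move=> FF ua vb; apply: cvg_big => [|i _]; first exact: add_continuous.
have coord (w : T -> 'rV[R]_m) (c : 'rV[R]_m) :
      w @ F --> c -> w x 0 i @[x --> F] --> c 0 i.
  by move=> wc; apply: (cvg_comp w (fun M : 'rV[R]_m => M 0 i) wc);
    exact: (@coord_continuous R 1 m 0 i c).
by apply: cvgM; exact: coord.
Qed.

Lemma within_continuous_prod (T1 T2 U1 U2 : topologicalType)
    (A1 : set T1) (A2 : set T2) (f1 : T1 -> U1) (f2 : T2 -> U2) :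
  {within A1, continuous f1} -> {within A2, continuous f2} ->
  {within A1 `*` A2, continuous (fun x => (f1 x.1, f2 x.2))}.
Proof.
move=> /subspace_continuousP c1 /subspace_continuousP c2.
apply/subspace_continuousP => -[x y] [/= Ax Ay]; apply: cvg_pair => /=.
  move=> P /(c1 x Ax) Px.
  have : nbhs (x, y) (fst @^-1` (fun z => A1 z -> P (f1 z))).
    by apply: cvg_fst; exact: Px.
  by apply: filterS => z zP [A1z _]; exact: zP.
move=> P /(c2 y Ay) Py.
have : nbhs (x, y) (snd @^-1` (fun z => A2 z -> P (f2 z))).
  by apply: cvg_snd; exact: Py.
by apply: filterS => z zP [_ A2z]; exact: zP.
Qed.

Section labelling.
Variable R : realType.

Lemma unit_sphere_delta m : unit_sphere R m.+1 (delta_mx 0 0).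
Proof.
rewrite /unit_sphere/= /dot (bigD1 0)//= big1 => [|i i0]; rewrite !mxE eqxx/=.
  by rewrite mulr1 addr0.
by rewrite (negbTE i0) mul0r.
Qed.

(** The pairs (p, q) with a vertex [w] such that [p w = 0] and [delta <= q w] form a compact set.
    There [dot (f p) (f q)] attains its maximum, which is less than 1 because [f] is injective and
    [p] differs from [q]. *)
Lemma realization_gap (V : finType) (Q : set (set V)) m
    (f : prod_topology (fun _ : V => R) -> 'rV[R]_m) (delta : R) :
  is_simplicial_complex Q -> 0 < delta ->
  set_fun (realization Q) (unit_sphere R m) f ->
  {within realization Q, continuous f} ->
  {in realization Q &, injective f} ->
  exists2 eps : R, 0 < eps <= pi & forall p q w,
    realization Q p -> realization Q q -> p w = 0 -> delta <= q w ->
    dot (f p) (f q) < cos eps.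
Proof.
move=> cQ d0 fS cf finj.
pose RV := prod_topology (fun _ : V => R).
pose K : set RV := realization Q.
pose E w : set (RV * RV) := [set pq | pq.1 w = 0 /\ delta <= pq.2 w].
pose E' := (K `*` K) `&` \bigcup_(w in [set: V]) E w.
have cE : compact E'.
  apply: compact_closedI.
    by apply: compact_setX; exact: compact_realization.
  apply: closed_bigcup => [|w _]; first exact: finite_finset.
  have -> : E w = ((fun pq => pq.1 w) @^-1` [set x | x = 0]) `&`
                  ((fun pq => pq.2 w) @^-1` [set x | delta <= x]) by [].
  apply: closedI.
    apply: preimage_closed; last exact: closed_eq.
    move=> x _; exact: (@cvg_comp _ _ _ fst (fun q : RV => q w) _ _ _ cvg_fst
      (@continuous_coord R V w x.1)).
  apply: preimage_closed; last exact: closed_ge.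
  move=> x _; exact: (@cvg_comp _ _ _ snd (fun q : RV => q w) _ _ _ cvg_snd
    (@continuous_coord R V w x.2)).
have [E0|[pq0 Epq0]] : E' = set0 \/ E' !=set0.
  by have [->|/set0P] := eqVneq E' set0; [left|right].
  exists pi; rewrite ?pi_gt0 ?lexx// => p q w Kp Kq pw qw.
  suff : E' (p, q) by rewrite E0.
  by split=> //; exists w.
have [|c /set_mem[[Kc1 Kc2] [w _ [c1w c2w]]] cmax] :=
    @compact_EVT_max _ R (fun pq => dot (f pq.1) (f pq.2)) E' (ex_intro _ pq0
      Epq0) cE.
  apply: (@continuous_subspaceW _ _ _ (K `*` K)); first exact: subIsetl.
  have /subspace_continuousP cff := within_continuous_prod cf cf.
  apply/subspace_continuousP => x /cff fx; apply: cvg_dot.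
    exact: (@cvg_comp _ _ _ _ fst _ _ _ fx cvg_fst).
  exact: (@cvg_comp _ _ _ _ snd _ _ _ fx cvg_snd).
set M := dot _ _ in cmax.
have /andP[M_ge M_le] := dot_unit_sphere (fS _ Kc1) (fS _ Kc2).
have M1 : M < 1.
  rewrite lt_neqAle M_le andbT; apply/eqP.
  move/(dot_unit_sphere_eq1 (fS _ Kc1) (fS _ Kc2)) => /finj;
    rewrite !inE => /(_ Kc1 Kc2) cc.
  by move: c2w; rewrite -cc c1w leNgt d0.
have M11 : -1 <= M <= 1 by rewrite M_ge M_le.
have aM : 0 < acos M by rewrite acos_gt0// M_ge.
have aMpi := acos_lepi M11.
(* Half of the least angle between such images, to make the inequality strict. *)
exists (acos M / 2); first by apply/andP; split; lra.
move=> p q v Kp Kq pv qv.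
apply: (@le_lt_trans _ _ M).
  by apply: (cmax (p, q)); rewrite inE; split=> //; exists v.
rewrite -[ltLHS](@acosK R M) ?in_itv//= ltr_cos ?in_itv/=; first lra.
  by apply/andP; split; lra.
by apply/andP; split; lra.
Qed.

(** The largest coordinate is at least the average one. *)
Lemma realization_large_coord (V : finType) (Q : set (set V))
    (p : prod_topology (fun _ : V => R)) (v0 : V) :
  realization Q p -> #|V|%:R^-1 <= p [arg max_(w > v0) p w]%O.
Proof.
move=> [p0 p1 _]; case: arg_maxP => //= w _ wmax.
have V0 : 0 < #|V|%:R :> R by rewrite ltr0n; apply/card_gt0P; exists v0.
rewrite -(ler_pM2l V0) mulfV ?gt_eqF// -[leLHS]p1.
rewrite (le_trans (ler_sum _ (fun v _ => wmax v isT)))//.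
by rewrite sumr_const mulr_natl.
Qed.

Lemma linear_extension_involutive (V : finType) (nu : V -> V)
    (p : prod_topology (fun _ : V => R)) :
  involutive nu -> linear_extension nu p = p \o nu.
Proof.
move=> nuK; apply/funext => v; rewrite /linear_extension/=.
rewrite (big_pred1 (nu v)) // => w /=.
by apply/eqP/eqP => [<-|->]; rewrite nuK.
Qed.

Lemma admits_sphere_labelling (X : Type) (H : set (X -> bool)) m :
  admits_simplicial_sphere R H m ->
  exists (c : 'rV[R]_m.+1 -> X * bool) (eps : R), 0 < eps /\
  forall u, unit_sphere R m.+1 u -> exists2 h, H h &
  forall v, unit_sphere R m.+1 v ->
    (geodesic_dist u v <= eps -> h (c v).1 = (c v).2) /\
    (geodesic_dist (- u) v <= eps -> h (c v).1 = ~~ (c v).2).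
Proof.
move=> [X' _ [V [Q [nu [beta [[cQ nuK nuQ _ [f [g [fS gK cf _ [gf fg]]] fN]]
  betaQ betaN]]]]]].
(* Without vertices the realization would be empty, but the sphere is not. *)
have [v0 _|V0] := pickP (@predT V); last first.
  have [_ + _] := gK _ (unit_sphere_delta m).
  by rewrite big_pred0// => /esym/eqP; rewrite oner_eq0.
have nuS p : realization Q p -> realization Q (p \o nu).
  move=> [p0 p1 pQ]; split=> [v|| ]; first exact: p0.
    rewrite -[RHS]p1 [RHS](reindex_inj (inv_inj nuK)); exact: eq_bigr.
  have -> : [set v | (p \o nu) v != 0] = nu @` [set v | p v != 0].
    apply/seteqP; split=> [v /= pv|_ [v pv <-]/=]; last by rewrite nuK.
    by exists (nu v) => //; rewrite nuK.
  exact: nuQ.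
have cV0 : 0 < #|V|%:R^-1 :> R.
  by rewrite invr_gt0 ltr0n; apply/card_gt0P; exists v0.
have finj : {in realization Q &, injective f}.
  by move=> p q /set_mem Kp /set_mem Kq /(congr1 g); rewrite !gf.
have [eps /andP[eps0 epspi] gap] := realization_gap cQ cV0 fS cf finj.
have epsI : 0 <= eps <= pi by rewrite ltW.
pose b w := (val (beta w).1, (beta w).2).
pose c v := b [arg max_(w > v0) g v w]%O.
(* If [p w] were 0, [gap] would separate [f p] from [v = f (g v)], since the largest coordinate of
   [g v] is at least 1/#|V|. *)
have near p v w : realization Q p -> unit_sphere R m.+1 v ->
    geodesic_dist (f p) v <= eps -> w = [arg max_(w > v0) g v w]%O -> p w != 0.
  move=> Kp Sv + ew; rewrite geodesic_dist_le//; last exact: fS.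
  apply: contraTneq => pw; rewrite -ltNge -[v]fg//.
  apply: (gap _ _ w) => //; first exact: gK.
  by rewrite ew; apply: realization_large_coord; exact: gK.
exists c, eps; split=> // u Su.
have Ku := gK _ Su.
have [_ _ /betaQ[[_ [h Hh <-] hE] _]] := Ku.
exists h => // v Sv; rewrite /c; set w := [arg max_(w > v0) _]%O; split=> uv.
  apply: (hE (beta w)); exists w => //.
  by apply: (near _ v) => //; rewrite fg.
(* [f] sends [g u \o nu] to [- u], so [near] applies to it: closeness of [v] to [- u] puts [nu w]
   into the support of [g u]. *)
have nuw : g u (nu w) != 0.
  apply: (near (g u \o nu) v) => //; first exact: nuS.
  by rewrite -linear_extension_involutive// fN// fg.
by have := hE (beta (nu w)) (ex_intro2 _ _ (nu w) nuw erefl); rewrite betaN.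
Qed.

Lemma admits_sphere_disambiguates (X : Type) (H : set (X -> bool)) (k j : nat) :
  admits_simplicial_sphere R H (k + j)%N ->
  exists c : Sphere R (Posz k) -> X * bool, disambiguates (pullback c H).
Proof.
move=> /admits_sphere_labelling[c [eps [eps0 hc]]].
(* Padding with zeros embeds S^k as a great subsphere of S^(k+j); it preserves dot products, hence
   angles, and commutes with the antipode. *)
pose iota (u : 'rV[R]_k.+1) : 'rV[R]_(k.+1 + j) := row_mx u (0 : 'rV[R]_j).
have dot_iota u v : dot (iota u) (iota v) = dot u v.
  rewrite /dot (@big_split_ord _ _ _ k.+1 j) /= [X in _ + X]big1 ?addr0.
    by apply: eq_bigr => i _; rewrite /iota !row_mxEl.
  by move=> i _; rewrite /iota !row_mxEr mxE mul0r.
have iotaN u : iota (- u) = - iota u by rewrite /iota opp_row_mx oppr0.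
exists (fun v => c (iota (val v))), eps => // -[u Su].
have [|h Hh hE] := hc (iota u).
  by rewrite /unit_sphere/= dot_iota; exact: set_mem Su.
exists (fun v => h (c (iota (val v))).1 == (c (iota (val v))).2);
  first by exists h.
move=> [v Sv] /=; have [|h1 h2] := hE (iota v).
  by rewrite /unit_sphere/= dot_iota; exact: set_mem Sv.
rewrite /geodesic_dist -(dot_iota u) -(dot_iota (- u)) iotaN; split.
  by move=> /h1 ->; rewrite eqxx.
by move=> /h2 ->; case: (c _).2.
Qed.

End labelling.

(** * The Freudenthal-Kuhn triangulation *)

(** Existence of barycentric coordinates in the Kuhn triangulation: [b] is the integral part of the
    point, [s] its fractional part and [A] the set of its non-integral coordinates. The proof is by
    induction on the size of [A]. *)
Lemma kuhn_decomposition (R : realFieldType) (n M : nat) (A : {set 'I_n})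
    (b : {ffun 'I_n -> 'I_M.+1}) (s : 'I_n -> R) :
  (forall i, i \in A -> 0 < s i < 1) -> (forall i, i \notin A -> s i = 0) ->
  (forall i, i \in A -> (b i < M)%N) ->
  exists p : {ffun 'I_n -> 'I_M.+1} -> R, [/\ forall v, 0 <= p v, \sum_v p v =
    1,
    forall i, \sum_v p v * (v i)%:R = (b i)%:R + s i,
    forall v, p v != 0 -> forall i, (b i <= v i <= b i + (i \in A))%N
  & forall v w, p v != 0 -> p w != 0 ->
      (forall i, (v i <= w i)%N) \/ (forall i, (w i <= v i)%N)].
Proof.
elim: {A}_.+1 {-2}A (ltnSn #|A|) s => // m IH A.
rewrite ltnS => Am s sA sNA bA.
have sum_delta (c : R) u (g : {ffun 'I_n -> 'I_M.+1} -> R) :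
    \sum_v c * (v == u)%:R * g v = c * g u.
  rewrite (bigD1 u)//= eqxx mulr1 big1 ?addr0// => v /negbTE ->.
  by rewrite mulr0 mul0r.
have [A0|/set0Pn[j jA]] := eqVneq A (@finset.set0 _).
  exists (fun v => (v == b)%:R); split.
  - by move=> v; rewrite ler0n.
  - transitivity (\sum_v 1 * (v == b)%:R * 1 : R); last first.
      by rewrite (sum_delta 1 b (fun=> 1)) mulr1.
    by apply: eq_bigr => v _; rewrite mul1r mulr1.
  - move=> i; rewrite sNA ?A0 ?finset.inE// addr0.
    have := sum_delta 1 b (fun v => (v i)%:R); rewrite mul1r => <-.
    by apply: eq_bigr => v _; rewrite mul1r.
  - by move=> v; rewrite pnatr_eq0 eqb0 negbK => /eqP -> i;
    rewrite leqnn leq_addr.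
  - move=> v w; rewrite !pnatr_eq0 !eqb0 !negbK => /eqP -> /eqP ->.
    by left.
(* With c the least s_i, i in A, the point b + s is the convex combination
   c (b + 1_A) + (1 - c) (b + s'), where s' vanishes at one more index. *)
have [i0 i0A i0min] := @arg_minP _ _ _ j (mem A) s jA.
set c := s i0 in i0min.
have /andP[c0 c1] : 0 < c < 1 by exact: sA.
pose A' := (A :\: [set i | s i == c])%SET.
pose s' i := if i \in A then (s i - c) / (1 - c) else 0.
have c1' : 0 < 1 - c by rewrite subr_gt0.
have A'A i : i \in A' -> i \in A by rewrite !finset.inE => /andP[].
have s'E i : c * (i \in A)%:R + (1 - c) * s' i = s i.
  rewrite /s'; case: ifPn => [iA|/sNA ->]; last by rewrite !mulr0 addr0.
  by rewrite mulr1 mulrCA divff ?gt_eqF// mulr1 addrC subrK.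
have [||||p' [p'0 p'1 p'b p's p'c]] := IH A' _ s'.
- apply: leq_trans Am; apply/proper_card/properP; split; first exact: subsetDl.
  by exists i0; rewrite // !finset.inE eqxx.
- move=> i iA'; have iA := A'A i iA'; rewrite /s' iA.
  move: iA'; rewrite !finset.inE iA andbT => sic.
  have ci : c < s i by rewrite lt_neqAle eq_sym sic i0min.
  rewrite divr_gt0 ?subr_gt0//= ltr_pdivrMr// mul1r ltrD2r;
    by case/andP: (sA i iA).
- move=> i; rewrite !finset.inE negb_and negbK => /orP[/eqP sic|iA].
    by rewrite /s'; case: ifP => // _; rewrite sic subrr mul0r.
  by rewrite /s' (negbTE iA).
- by move=> i /A'A /bA.
(* The vertex b + 1_A, which dominates the support of [p']. Since [b i < M] on [A], [inord] never
   takes its default value. *)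
pose u : {ffun 'I_n -> 'I_M.+1} := [ffun i => inord (b i + (i \in A))].
have uE i : u i = (b i + (i \in A))%N :> nat.
  rewrite ffunE inordK// ltnS; case: (boolP (i \in A)) => [/bA|_].
    by rewrite addn1.
  by rewrite addn0 -ltnS.
have p'u v : p' v != 0 -> forall i, (v i <= u i)%N.
  move=> /p's + i => /(_ i)/andP[_ /leq_trans]; apply; rewrite uE leq_add2l.
  by case: (boolP (i \in A')) => // /A'A ->.
pose p v := c * (v == u)%:R + (1 - c) * p' v.
have p_supp v : p v != 0 -> v = u \/ p' v != 0.
  by rewrite /p; have [->|] := eqVneq v u;
    [left|rewrite mulr0 add0r mulf_eq0 negb_or => _ /andP[]; right].
exists p; split.
- by move=> v; rewrite addr_ge0// mulr_ge0// ?ler0n ?p'0// ltW.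
- rewrite /p big_split/= -[X in _ + X]mulr_sumr p'1.
  under eq_bigr do rewrite -[_ * _]mulr1.
  by rewrite (sum_delta c u (fun=> 1)) !mulr1 addrC subrK.
- move=> i; rewrite -s'E /p; under eq_bigr do rewrite mulrDl.
  rewrite big_split/= sum_delta uE.
  under [X in _ + X]eq_bigr do rewrite -mulrA.
  rewrite -mulr_sumr p'b natrD; lra.
- move=> v /p_supp[->|p'v] i; first by rewrite uE leq_addr leqnn.
  have /andP[-> /leq_trans ->//] := p's v p'v i.
  by rewrite leq_add2l; case: (boolP (i \in A')) => // /A'A ->.
- move=> v w /p_supp[->|p'v] /p_supp[->|p'w].
  + by left.
  + by right; exact: p'u.
  + by left; exact: p'u.
  + exact: p'c.
Qed.

Section kuhn_uniqueness.
Variables (R : realFieldType) (V : finType) (n : nat) (x : V -> 'I_n.+1 -> nat).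
Hypothesis x_inj : forall v w, x v =1 x w -> v = w.

(** This relation is not transitive, so a chain has to require it of all pairs and not only of
    successive vertices. *)
Definition kuhn_le (v w : V) := forall i, (x v i <= x w i <= (x v i).+1)%N.

Definition kuhn_chain (F : set V) :=
  forall v w, F v -> F w -> kuhn_le v w \/ kuhn_le w v.

Let clamp (t : R) : R := if t <= 0 then 0 else if 1 <= t then 1 else t.

(** For a distribution [p] on the vertices, [tail] is the tail distribution of the i-th coordinate,
    and [upper] is the mass of the orthant above [a]. *)
Let tail (p : V -> R) i a := \sum_(v | (a <= x v i)%N) p v.

Let upper (p : V -> R) (a : V) := \sum_(v | [forall i, (x a i <= x v i)%N]) p v.

(* On a chain the i-th coordinate takes at most two consecutive values, so that
   its distribution is determined by its mean. *)
Let tailE (p : V -> R) i a : (forall v, 0 <= p v) -> \sum_v p v = 1 ->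
  kuhn_chain [set v | p v != 0] ->
  tail p i a = clamp (\sum_v p v * (x v i)%:R - a%:R + 1).
Proof.
move=> p0 p1 pc.
have [v0 pv0] : exists v, p v != 0.
  apply: contrapT => /forallNP h; move/eqP: p1;
    rewrite big1 ?(eq_sym 0) ?oner_eq0//.
  by move=> v _; apply/eqP; apply: contrapT => /negP; exact: h.
have [w pw wmin] := @arg_minnP _ v0 (fun v => p v != 0) (fun v => x v i) pv0.
set c := x w i in wmin.
have xc v : p v != 0 -> x v i = (c + (c < x v i))%N.
  move=> pv; have cv := wmin v pv.
  have : (x v i <= c.+1)%N.
    have [/(_ i)/andP[//]|/(_ i)/andP[vw _]] := pc w v pw pv.
    exact: leq_trans vw _.
  move: cv; rewrite leq_eqVlt => /orP[/eqP <-|cv]; first by rewrite ltnn addn0.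
  by rewrite cv addn1 => vc; apply/eqP; rewrite eqn_leq vc cv.
have XE : \sum_v p v * (x v i)%:R = c%:R + tail p i c.+1.
  have -> : c%:R = \sum_v p v * c%:R by rewrite -mulr_suml p1 mul1r.
  rewrite /tail [X in _ + X]big_mkcond -big_split/=.
  apply: eq_bigr => v _; have [->|pv] := eqVneq (p v) 0.
    by rewrite !mul0r if_same addr0.
  rewrite {1}(xc v pv) natrD mulrDr; congr (_ + _).
  by case: ifP; rewrite ?mulr1 ?mulr0.
have tail_ge0 a' : 0 <= tail p i a' by exact: sumr_ge0.
have tail_le1 a' : tail p i a' <= 1.
  by rewrite -p1 [leRHS](bigID (fun v => (a' <= x v i)%N))/= lerDl sumr_ge0.
have := tail_ge0 c.+1; have := tail_le1 c.+1.
(* The mean is [c + tail p i c.+1], where [c] is the least value taken. The argument of [clamp] is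
   at least 1 if a <= c, equals the tail if a = c+1, and is at most 0 if a >= c+2. *)
rewrite XE; have [ac|] := leqP a c.
  have -> : tail p i a = 1.
    rewrite -p1 /tail big_mkcond/=; apply: eq_bigr => v _.
    case: ifPn => //; rewrite -ltnNge => va; apply/eqP.
    apply: contraTT va; rewrite eq_sym => pv; rewrite -leqNgt.
    exact: leq_trans (wmin v pv).
  have : a%:R <= c%:R :> R by rewrite ler_nat.
  move=> *; rewrite /clamp; case: ifPn => [h|_]; first by lra.
  by case: ifPn => // h; lra.
rewrite leq_eqVlt => /orP[/eqP <-|ca].
  rewrite -natr1 => h1 h0; rewrite /clamp; case: ifPn => h; first by lra.
  by case: ifPn => h'; lra.
have -> : tail p i a = 0.
  apply: big1 => v av; apply/eqP; apply: contraTT av => pv.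
  rewrite -ltnNge; apply: leq_trans ca; rewrite (xc v pv).
  by case: (c < x v i)%N; rewrite ?addn1 ?addn0// ltnS.
have : c.+2%:R <= a%:R :> R by rewrite ler_nat.
rewrite -2!natr1 => *; rewrite /clamp; case: ifPn => // h; by lra.
Qed.

(* The sets {v in the support : a_i <= v_i} are nested, so that their
   intersection over i is one of them. *)
Let upperE (p : V -> R) a : kuhn_chain [set v | p v != 0] ->
  exists i, upper p a = tail p i (x a i).
Proof.
move=> pc.
pose B i := [set v | (p v != 0) && (x a i <= x v i)%N]%SET.
have [i0 _ i0min] := @arg_minnP _ ord0 xpredT (fun i => #|B i|) isT.
have BB i : B i0 \subset B i.
  apply/negP => /negP /subsetPn[v vB vNB].
  suff : (#|B i| < #|B i0|)%N by rewrite ltnNge i0min.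
  apply/proper_card/properP; split; last by exists v.
  apply/fintype.subsetP => w; move: vB vNB; rewrite !finset.inE.
  move=> /andP[pv av] + /andP[pw aw]; rewrite pv pw/= -ltnNge => va.
  have [vw|wv] := pc v w pv pw.
    by apply: leq_trans av _; case/andP: (vw i0).
  by have /andP[wvi _] := wv i; move: (leq_trans aw wvi); rewrite leqNgt va.
exists i0; rewrite /upper /tail big_mkcond [RHS]big_mkcond/=.
apply: eq_bigr => v _; have [->|pv] := eqVneq (p v) 0;
  first by rewrite !if_same.
congr (if _ then _ else _); apply/forallP/idP => [/(_ i0)//|av i].
have /fintype.subsetP/(_ v) := BB i.
by rewrite !finset.inE pv av => /(_ isT).
Qed.

Let upper_le (p : V -> R) a i : (forall v, 0 <= p v) -> upper p a <= tail p i
  (x a i).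
Proof.
move=> p0; rewrite /upper /tail big_mkcond [leRHS]big_mkcond/=.
apply: ler_sum => v _; case: ifPn => [/forallP/(_ i) -> //|_].
by case: ifP.
Qed.

(** The means determine the tails, by [tailE]. The mass of an orthant is the minimum over i of the
    tails, by [upperE] and [upper_le], and the masses of all orthants determine the distribution. *)
Lemma kuhn_uniqueness (p q : V -> R) :
  (forall v, 0 <= p v) -> \sum_v p v = 1 -> kuhn_chain [set v | p v != 0] ->
  (forall v, 0 <= q v) -> \sum_v q v = 1 -> kuhn_chain [set v | q v != 0] ->
  (forall i, \sum_v p v * (x v i)%:R = \sum_v q v * (x v i)%:R) ->
  p =1 q.
Proof.
move=> p0 p1 pc q0 q1 qc pq.
have tpq i a : tail p i a = tail q i a by rewrite !tailE// pq.
have upq a : upper p a = upper q a.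
  apply/eqP; rewrite eq_le; apply/andP; split.
    by have [i ->] := upperE a qc; rewrite -tpq upper_le.
  by have [i ->] := upperE a pc; rewrite tpq upper_le.
move=> v; apply/eqP; apply: contrapT => /negP pqv.
(* Moebius inversion, at a vertex of disagreement with maximal height. *)
have [w pqw wmax] := @arg_maxnP _ v (fun v => p v != q v) (fun v => \sum_i x v
  i)%N pqv.
move: pqw => /eqP; apply; have := upq w; rewrite /upper.
have ww : [forall i, (x w i <= x w i)%N] by exact/forallP.
rewrite (bigD1 w)//= [in RHS](bigD1 w)//=.
rewrite [X in _ + X = _](eq_bigr q); first by move/addIr.
move=> z /andP[/forallP wz zw]; apply/eqP; apply: contrapT => /negP /wmax.
rewrite /= leqNgt => /negP; apply.
have [i wzi] : exists i, x w i != x z i.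
  apply: contrapT => /forallNP h; move/eqP: zw; apply; apply: x_inj => i.
  by apply/esym/eqP; apply: contrapT => /negP; exact: h.
rewrite (bigD1 i)//= [ltnRHS](bigD1 i)//= -addSn leq_add//.
  by rewrite ltn_neqAle wzi wz.
by apply: leq_sum.
Qed.

End kuhn_uniqueness.

(** * The triangulated boundary of the cube *)

Section cube_boundary.
Variables (R : realType) (k N : nat).
Hypothesis N0 : (0 < N)%N.

(* The cube is [0, 2N]^(k+1) here; cube_point translates it to be centered at
   the origin. *)
Definition cube_boundary : {pred {ffun 'I_k.+1 -> 'I_(N.*2).+1}} :=
  [pred v : {ffun 'I_k.+1 -> 'I_(N.*2).+1} |
    [exists i, (v i == 0 :> nat) || (v i == N.*2 :> nat)]].

Definition cube_vertex := {v | v \in cube_boundary}.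

Definition lattice_coord (v : cube_vertex) (i : 'I_k.+1) : nat := val v i.

(** The common facet keeps simplices on the boundary: for N = 1 in the plane, (1,0) and (2,1) form a
    chain of boundary points whose segment crosses the interior. *)
Definition cube_complex : set (set cube_vertex) :=
  [set F | kuhn_chain lattice_coord F /\
    exists i c, (c = 0%N \/ c = N.*2) /\ forall v, F v -> lattice_coord v i =
      c].

Fact cube_antipode_subproof (v : cube_vertex) :
  [ffun i => rev_ord (val v i)] \in cube_boundary.
Proof.
case: v => v /= /existsP[i vi]; apply/existsP; exists i; rewrite ffunE /= subSS.
by case/orP: vi => /eqP ->; rewrite ?subn0 ?subnn eqxx ?orbT.
Qed.

Definition cube_antipode (v : cube_vertex) : cube_vertex :=
  exist (fun u => u \in cube_boundary) _ (cube_antipode_subproof v).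

Lemma lattice_coord_antipode v i :
  lattice_coord (cube_antipode v) i = (N.*2 - lattice_coord v i)%N.
Proof. by rewrite /lattice_coord/= ffunE /= subSS. Qed.

Lemma lattice_coord_le v i : (lattice_coord v i <= N.*2)%N.
Proof. by rewrite -ltnS /lattice_coord. Qed.

Lemma lattice_coord_inj v w : lattice_coord v =1 lattice_coord w -> v = w.
Proof.
by move=> vw; apply/val_inj/ffunP => i; apply/val_inj; exact: vw.
Qed.

Lemma cube_antipodeK : involutive cube_antipode.
Proof.
move=> v; apply: lattice_coord_inj => i.
by rewrite !lattice_coord_antipode subKn// lattice_coord_le.
Qed.

Lemma is_simplicial_complex_cube : is_simplicial_complex cube_complex.
Proof.
split=> [v|F G FG [Gc [i [c [cN Gi]]]]]; last first.
  split=> [v w /FG Gv /FG Gw|]; first exact: Gc.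
  by exists i, c; split=> // v /FG; exact: Gi.
split=> [_ _ -> ->|]; first by left=> i; rewrite leqnn leqnSn.
have /existsP[i /orP[]/eqP vi] := valP v.
  by exists i, 0%N; split=> [|_ ->]; first left.
by exists i, N.*2; split=> [|_ ->]; first right.
Qed.

Lemma simplicial_map_cube_antipode :
  simplicial_map cube_complex cube_complex cube_antipode.
Proof.
move=> F [Fc [i [c [cN Fi]]]]; split=> [_ _ [v Fv <-] [w Fw <-]|].
  have le_anti v' w' : kuhn_le lattice_coord v' w' ->
      kuhn_le lattice_coord (cube_antipode w') (cube_antipode v').
    move=> vw j; rewrite !lattice_coord_antipode; have := vw j.
    have := lattice_coord_le v' j; have := lattice_coord_le w' j; lia.
  by have [vw|wv] := Fc v w Fv Fw; [right|left]; exact: le_anti.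
exists i, (N.*2 - c)%N; split.
  by case: cN => ->; rewrite ?subn0 ?subnn; [right|left].
by move=> _ [v Fv <-]; rewrite lattice_coord_antipode Fi.
Qed.

Lemma cube_complex_antipodal F v :
  cube_complex F -> ~ (F v /\ F (cube_antipode v)).
Proof.
move=> [_ [i [c [cN Fi]]]] [/Fi vi /Fi]; rewrite lattice_coord_antipode vi.
by case: cN => ->; rewrite -addnn; lia.
Qed.

Definition cube_point (v : cube_vertex) : 'rV[R]_k.+1 :=
  \row_i ((lattice_coord v i)%:R - N%:R).

Lemma cube_point_antipode v : cube_point (cube_antipode v) = - cube_point v.
Proof.
apply/rowP => i; rewrite !mxE lattice_coord_antipode natrB ?lattice_coord_le//.
by rewrite -addnn natrD; lra.
Qed.

Local Notation RV := (prod_topology (fun _ : cube_vertex => R)).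
Local Notation K := (realization cube_complex : set RV).

(** The extension of [cube_point] that is linear on simplices; the lemmas below show that it maps
    the realization bijectively onto the boundary of the cube [-N, N]^(k+1). *)
Definition cube_bary (p : RV) : 'rV[R]_k.+1 := \sum_v p v *: cube_point v.

Lemma cube_baryE p i : K p ->
  cube_bary p 0 i = \sum_v p v * (lattice_coord v i)%:R - N%:R.
Proof.
move=> [_ p1 _]; have -> : N%:R = \sum_v p v * N%:R :> R.
  by rewrite -mulr_suml p1 mul1r.
rewrite -sumrB summxE; apply: eq_bigr => v _.
by rewrite !mxE mulrBr.
Qed.

Lemma cube_bary_le p i : K p -> `|cube_bary p 0 i| <= N%:R.
Proof.
move=> Kp; rewrite cube_baryE//; case: Kp => p0 p1 _.
have X0 : 0 <= \sum_v p v * (lattice_coord v i)%:R.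
  by apply: sumr_ge0 => v _; rewrite mulr_ge0 ?ler0n.
have X2 : \sum_v p v * (lattice_coord v i)%:R <= N%:R + N%:R.
  have -> : N%:R + N%:R = \sum_v p v * (N.*2)%:R :> R.
    by rewrite -mulr_suml p1 mul1r -addnn natrD.
  by apply: ler_sum => v _; rewrite ler_wpM2l// ler_nat lattice_coord_le.
by rewrite ler_norml; apply/andP; split; lra.
Qed.

Lemma cube_bary_facet p : K p -> exists i, `|cube_bary p 0 i| = N%:R.
Proof.
move=> Kp; have [p0 p1 [_ [i [c [cN ci]]]]] := Kp.
exists i; rewrite cube_baryE//.
have -> : \sum_v p v * (lattice_coord v i)%:R = c%:R.
  rewrite -[c%:R]mul1r -[X in X * _]p1 mulr_suml; apply: eq_bigr => v _.
  by have [->|pv] := eqVneq (p v) 0; rewrite ?mul0r// (ci v pv).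
case: cN => ->; first by rewrite sub0r normrN normr_nat.
by rewrite -addnn natrD addrK normr_nat.
Qed.

Lemma cube_bary_antipode p : cube_bary (p \o cube_antipode) = - cube_bary p.
Proof.
rewrite /cube_bary [LHS](reindex_inj (inv_inj cube_antipodeK)) -sumrN.
by apply: eq_bigr => v _; rewrite /= cube_antipodeK cube_point_antipode scalerN.
Qed.

Lemma cube_bary_inj : {in K &, injective cube_bary}.
Proof.
move=> p q /set_mem Kp /set_mem Kq pq; apply/funext.
have [p0 p1 [pc _]] := Kp; have [q0 q1 [qc _]] := Kq.
apply: (kuhn_uniqueness lattice_coord_inj) => // i.
by apply: (@addIr _ (- N%:R)); rewrite -!cube_baryE// pq.
Qed.

Lemma cube_bary_surj (x : 'rV[R]_k.+1) :
  (forall i, `|x 0 i| <= N%:R) -> (exists i, `|x 0 i| = N%:R) ->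
  exists2 p, K p & cube_bary p = x.
Proof.
move=> xN [i0 xi0].
pose t i := x 0 i + N%:R.
have t0 i : 0 <= t i.
  by rewrite /t; have := xN i; rewrite ler_norml => /andP[]; lra.
have t2 i : t i <= (N.*2)%:R.
  by rewrite /t -addnn natrD; have := xN i; rewrite ler_norml => /andP[]; lra.
pose c i := Num.truncn (t i).
have cle i : (c i)%:R <= t i by rewrite truncn_le.
have cgt i : t i < (c i)%:R + 1 by rewrite natr1 truncnS_gt.
pose s i := t i - (c i)%:R.
pose b : {ffun 'I_k.+1 -> 'I_(N.*2).+1} := [ffun i => inord (c i)].
have bE i : b i = c i :> nat.
  by rewrite ffunE inordK// ltnS -(ler_nat R) (le_trans (cle i)).
have [|||p [p0 p1 pb ps pc]] :=
    @kuhn_decomposition R _ _ [set i | s i != 0]%SET b s.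
- move=> i; rewrite finset.inE /s => si; rewrite lt_neqAle eq_sym si/=.
  by have := cle i; have := cgt i => *; apply/andP; split; lra.
- by move=> i; rewrite finset.inE negbK => /eqP.
- move=> i; rewrite finset.inE bE /s -(ltr_nat R) => si.
  apply: lt_le_trans (t2 i).
  by rewrite lt_neqAle cle andbT; apply: contra_neq si => ->; rewrite subrr.
have [c0 [c0N ti0]] : exists c0, (c0 = 0%N \/ c0 = N.*2) /\ t i0 = c0%:R.
  rewrite /t; have := xi0; case: (ger0P (x 0 i0)) => _ xe.
    by exists N.*2; split; [right|rewrite -addnn natrD xe].
  by exists 0%N; split; [left|rewrite -xe subrr].
have cc0 : c i0 = c0 by rewrite /c ti0 natrK.
have si0 : s i0 = 0 by rewrite /s cc0 ti0 subrr.
(* The coordinate [i0] is integral, so the whole support agrees with [b] there and lies on one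
   facet. *)
have pi0 v : p v != 0 -> v i0 = c0 :> nat.
  move=> /ps/(_ i0); rewrite finset.inE si0 eqxx addn0 bE cc0 => h.
  by apply/eqP; rewrite eqn_leq andbC.
have p_bd v : v \notin cube_boundary -> p v = 0.
  move=> vb; apply/eqP; apply: contraNT vb => /pi0 vi0.
  by apply/existsP; exists i0; rewrite vi0; case: c0N => ->; rewrite eqxx ?orbT.
have sumE (g : {ffun 'I_k.+1 -> 'I_(N.*2).+1} -> R) :
    \sum_(v : cube_vertex) p (val v) * g (val v) = \sum_v p v * g v.
  rewrite -(big_sub cube_boundary (fun v => p v * g v)) big_mkcond/=.
  by apply: eq_bigr => v _; case: ifPn => // /p_bd ->; rewrite mul0r.
pose q : RV := fun v => p (val v).
have Kq : K q.
  split=> [v||]; first exact: p0.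
    have := sumE (fun=> 1); under eq_bigr do rewrite mulr1.
    by move=> ->; under eq_bigr do rewrite mulr1.
  split; last by exists i0, c0; split=> // v; exact: pi0.
  (* All coordinates lie in {b i, b i + 1}, which upgrades the componentwise order to [kuhn_le]. *)
  have near v w : q v != 0 -> q w != 0 -> forall i,
      (lattice_coord w i <= (lattice_coord v i).+1)%N.
    move=> /ps vb /ps wb i; have /andP[bv _] := vb i; have /andP[_ wbi] := wb i.
    apply: leq_trans wbi _; apply: (@leq_trans (b i + 1)).
      by rewrite leq_add2l; case: (_ \in _).
    by rewrite addn1 ltnS.
  move=> v w qv qw; have [vw|wv] := pc _ _ qv qw; [left|right] => i.
    by rewrite near// andbT; exact: vw.
  by rewrite near// andbT; exact: wv.
exists q => //; apply/rowP => i; rewrite cube_baryE//.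
have -> : \sum_v q v * (lattice_coord v i)%:R = (b i)%:R + s i.
  by rewrite -pb -sumE.
rewrite bE /s /t; lra.
Qed.

End cube_boundary.

(** * From a disambiguation to a simplicial sphere *)

Section normalize.
Variables (R : realType) (m : nat).
Implicit Types u v : 'rV[R]_m.

Definition normalize u := (Num.sqrt (dot u u))^-1 *: u.

Lemma dot_gt0 u : u != 0 -> 0 < dot u u.
Proof.
move=> u0; rewrite lt_neqAle dot_ge0 andbT eq_sym.
by apply: contra_neq u0 => /dot_eq0.
Qed.

Lemma normalize_unit u : u != 0 -> unit_sphere R m (normalize u).
Proof.
move=> /dot_gt0 u0; rewrite /unit_sphere/= /normalize dotZl dotZr mulrA.
by rewrite -invfM -expr2 sqr_sqrtr ?ltW// mulVf// gt_eqF.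
Qed.

Lemma normalizeN u : normalize (- u) = - normalize u.
Proof. by rewrite /normalize dotNl dotNr opprK scalerN. Qed.

Lemma normalizeZ (c : R) u : 0 < c -> unit_sphere R m u -> normalize (c *: u) =
  u.
Proof.
move=> c0 uu; rewrite /normalize dotZl dotZr uu mulr1 -expr2 sqrtr_sqr.
by rewrite gtr0_norm// scalerA mulVf ?scale1r// gt_eqF.
Qed.

Lemma normalize_eq u v : u != 0 -> v != 0 -> normalize u = normalize v ->
  exists2 c, 0 < c & u = c *: v.
Proof.
move=> /dot_gt0 u0 /dot_gt0 v0 uv.
exists (Num.sqrt (dot u u) / Num.sqrt (dot v v));
  first by rewrite divr_gt0 ?sqrtr_gt0.
by rewrite -scalerA -/(normalize v) -uv scalerA divff ?scale1r// gt_eqF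
  ?sqrtr_gt0.
Qed.

Lemma cvg_normalize (T : Type) (F : set_system T) (f : T -> 'rV[R]_m) u :
  Filter F -> u != 0 -> f @ F --> u -> normalize (f x) @[x --> F] --> normalize
    u.
Proof.
move=> FF /dot_gt0 u0 fu; apply: cvgZ => //.
apply: cvgV; first by rewrite gt_eqF ?sqrtr_gt0.
by apply: continuous_cvg; [exact: sqrt_continuous|exact: cvg_dot].
Qed.

(** With norms a and b, the hypothesis gives 2 u.v >= a^2 + b^2 - d >= 2ab - d; divide by ab >= r. A
    factor 2 in front of r is given away. *)
Lemma dot_normalize_ge u v (r d : R) : 0 < r -> r <= dot u u -> r <= dot v v ->
  dot (u - v) (u - v) <= d -> 1 - d / r <= dot (normalize u) (normalize v).
Proof.
move=> r0 ru rv uvd; have d0 := le_trans (dot_ge0 (u - v)) uvd.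
move: uvd; rewrite dotDl !dotDr !dotNl !dotNr opprK (dotC v u) => uvd.
have u0 : 0 <= dot u u by exact: dot_ge0.
have v0 : 0 <= dot v v by exact: dot_ge0.
rewrite /normalize dotZl dotZr.
move: (sqr_sqrtr u0) (sqr_sqrtr v0) (sqrtr_ge0 (dot u u)) (sqrtr_ge0 (dot v v)).
have := ler_wsqrtr ru; have := ler_wsqrtr rv.
move: (sqr_sqrtr (ltW r0)) (sqrtr_ge0 r).
set a := Num.sqrt (dot u u); set b := Num.sqrt (dot v v); set c := Num.sqrt r.
move=> cr c0 bc ac aE bE a0 b0.
have cab : r <= a * b by rewrite -cr expr2 ler_pM.
have ab0 : 0 < a * b by exact: lt_le_trans cab.
rewrite mulrA -invfM [leRHS]mulrC ler_pdivlMr// mulrBl mul1r.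
have dab : d <= d / r * (a * b).
  by rewrite mulrAC -mulrA ler_peMr// ler_pdivlMr// mul1r.
have := sqr_ge0 (a - b); rewrite sqrrB aE bE => ?; lra.
Qed.

End normalize.

Section cube_sphere.
Variables (R : realType) (k N : nat).
Hypothesis N0 : (0 < N)%N.

Local Notation V := (cube_vertex k N).
Local Notation Q := (@cube_complex k N).
Local Notation RV := (prod_topology (fun _ : V => R)).
Local Notation K := (realization Q : set RV).

Lemma cube_bary_neq0 (p : RV) : K p -> cube_bary p != 0.
Proof.
move=> /cube_bary_facet[i]; apply: contra_eq_neq => ->.
by rewrite mxE normr0 lt_eqF// ltr0n.
Qed.

Lemma cube_bary_continuous : continuous (@cube_bary R k N).
Proof.
apply: continuous_big => [|v _]; first exact: add_continuous.
move=> p.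
exact: (@cvgZr_tmp _ _ _ (nbhs p) (nbhs_filter p) _ _ _ (@continuous_coord R V
  v p)).
Qed.

Lemma cube_sphere : is_simplicial_sphere R k Q (@cube_antipode k N).
Proof.
split.
- exact: is_simplicial_complex_cube.
- exact: cube_antipodeK.
- exact: simplicial_map_cube_antipode.
- by move=> F v; exact: cube_complex_antipodal.
(* The homeomorphism is [cube_bary] followed by radial projection. As the realization is compact, a
   continuous bijection suffices. *)
exists (fun p => normalize (cube_bary p)); last first.
  move=> p Kp; rewrite linear_extension_involutive; last exact: cube_antipodeK.
  by rewrite cube_bary_antipode normalizeN.
apply: (realization_homeomorphism (is_simplicial_complex_cube k N)).
  apply: continuous_in_subspaceT => p /set_mem Kp.
  exact: (@cvg_normalize _ _ _ (nbhs p) _ _ (nbhs_filter p)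
    (cube_bary_neq0 Kp) (@cube_bary_continuous p)).
split.
- by move=> p /cube_bary_neq0; exact: normalize_unit.
- move=> p q Kp Kq pq; apply: cube_bary_inj => //.
  move/set_mem: Kp => Kp; move/set_mem: Kq => Kq.
  have [c c0 pcq] := normalize_eq (cube_bary_neq0 Kp) (cube_bary_neq0 Kq) pq.
  suff -> : cube_bary p = 1 *: cube_bary q by rewrite scale1r.
  have NR : 0 < N%:R :> R by rewrite ltr0n.
  (* Two boundary points of the cube on one ray coincide: each of them reaches a facet, and the
     other one stays inside the cube, so the ratio [c] is both at most and at least 1. *)
  rewrite pcq; congr (_ *: _); apply/eqP; rewrite eq_le; apply/andP; split.
    have [i qi] := cube_bary_facet Kq; have := cube_bary_le i Kp.
    by rewrite pcq mxE normrM qi gtr0_norm// ger_pMl.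
  have [i pi] := cube_bary_facet Kp; have := cube_bary_le i Kq.
  move: pi; rewrite pcq mxE normrM gtr0_norm// => cq qN.
  have q0 : 0 < `|cube_bary q 0 i| by rewrite -(pmulr_rgt0 _ c0) cq.
  by rewrite -(ler_pM2r q0) mul1r cq.
move=> y Sy.
have [i0 _ imax] := @arg_maxP _ _ _ (ord0 : 'I_k.+1) xpredT (fun i => `|y 0 i|)
  isT.
set M := `|y 0 i0| in imax.
have M0 : 0 < M.
  rewrite lt_neqAle normr_ge0 andbT; apply/eqP => M0.
  move: Sy; rewrite /unit_sphere/= /dot big1 => [/eqP|i _].
    by rewrite eq_sym oner_eq0.
  have := imax i isT; rewrite /= -M0 normr_le0 => /eqP ->.
  by rewrite mul0r.
(* Scaling [y] by N over its sup norm moves it to the boundary of the cube. *)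
have NM0 : 0 < N%:R / M by rewrite divr_gt0 ?ltr0n.
have [||p Kp px] := @cube_bary_surj R k N ((N%:R / M) *: y).
- move=> i; rewrite mxE normrM gtr0_norm// -mulrA ler_piMr ?ler0n//.
  by rewrite mulrC ler_pdivrMr// mul1r; exact: imax.
- by exists i0; rewrite mxE normrM gtr0_norm// -/M divfK// gt_eqF.
by exists p => //; rewrite px normalizeZ.
Qed.

Lemma cube_point_dot_ge (v : V) : (N%:R * N%:R <= dot (cube_point R v)
  (cube_point R v)).
Proof.
have [i vi] : exists i, cube_point R v 0 i = N%:R \/ cube_point R v 0 i = -
  N%:R.
  have /existsP[i vi] := valP v; exists i; rewrite mxE /lattice_coord.
  case/orP: vi => /eqP ->; first by right; rewrite sub0r.
  by left; rewrite -addnn natrD addrK.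
rewrite /dot (bigD1 i)//= ler_wpDr//.
  by apply: sumr_ge0 => j _; rewrite -expr2 sqr_ge0.
by case: vi => ->; rewrite ?mulrNN.
Qed.

Lemma cube_point_neq0 (v : V) : cube_point R v != 0.
Proof.
apply/eqP => v0; have := cube_point_dot_ge v; rewrite v0 /dot big1.
  by apply/negP; rewrite -ltNge mulr_gt0 ?ltr0n.
by move=> i _; rewrite mxE mul0r.
Qed.

Lemma cube_point_dist (F : set V) (v w : V) : Q F -> F v -> F w ->
  dot (cube_point R v - cube_point R w) (cube_point R v - cube_point R w) <=
    k.+1%:R.
Proof.
move=> [Fc _] Fv Fw; rewrite /dot.
have -> : k.+1%:R = \sum_(i < k.+1) 1 :> R by rewrite sumr_const card_ord.
apply: ler_sum => i _; rewrite !mxE.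
have le1 (a b : nat) : (a <= b <= a.+1)%N -> 0 <= (b%:R - a%:R : R) <= 1.
  move=> /andP[]; rewrite -2!(ler_nat R) -natr1 => ab ba.
  by apply/andP; split; lra.
set x := (lattice_coord v i)%:R; set y := (lattice_coord w i)%:R.
by case: (Fc v w Fv Fw) => /(_ i)/le1/andP[]; rewrite -/x -/y => *; nra.
Qed.

End cube_sphere.

Section fine_spheres.
Variables (R : realType) (k : nat).

Lemma fine_cube (eps : R) : 0 < eps -> exists2 N, (0 < N)%N &
  forall F (v w : cube_vertex k N), cube_complex F -> F v -> F w ->
  geodesic_dist (normalize (cube_point R v)) (normalize (cube_point R w)) <=
    eps.
Proof.
move=> eps0.
pose e : R := Num.min eps pi.
have e0 : 0 < e by rewrite lt_min eps0 pi_gt0.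
have epi : 0 <= e <= pi by rewrite ltW// ge_min lexx orbT.
have c1 : 0 < 1 - cos e.
  by rewrite subr_gt0 -cos0 ltr_cos// ?in_itv/= ?lexx ?pi_ge0.
(* Chosen so that 1 - (k+1)/r = cos e. Vertices have squared norm at least N^2 >= N > r, and those
   of a common simplex have squared distance at most k+1. *)
pose r : R := k.+1%:R / (1 - cos e).
have r0 : 0 < r by rewrite divr_gt0 ?ltr0n.
exists (Num.truncn r).+1 => //; set N := (Num.truncn r).+1.
move=> F v w QF Fv Fw; apply: (@le_trans _ _ e); last by rewrite ge_min lexx.
have N0 : (0 < N)%N by [].
have N1 : 1 <= N%:R :> R by rewrite ler1n.
have rN : r <= N%:R * N%:R.
  by apply: (@le_trans _ _ N%:R);
    [exact/ltW/truncnS_gt|rewrite ler_peMr// ler0n].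
rewrite geodesic_dist_le//; try exact: normalize_unit (cube_point_neq0 R N0 _).
have := dot_normalize_ge r0 (le_trans rN (cube_point_dot_ge R v))
  (le_trans rN (cube_point_dot_ge R w)) (cube_point_dist R QF Fv Fw).
apply: le_trans; rewrite /r invfM invrK mulrA divff ?mul1r;
  last by rewrite gt_eqF ?ltr0n.
by rewrite opprB addrCA subrr addr0.
Qed.

Lemma disambiguates_admits_sphere (D : set (Sphere R (Posz k) -> bool)) :
  D !=set0 -> disambiguates D -> admits_simplicial_sphere R D k.
Proof.
move=> [h0 Dh0] [eps eps0 hD].
have [N N0 fine] := fine_cube eps0.
pose nu := @cube_antipode k N.
pose phi (v : cube_vertex k N) : Sphere R (Posz k) :=
  exist (fun u => u \in unit_sphere R k.+1) _
    (mem_set (normalize_unit (cube_point_neq0 R N0 v))).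
have phiN v : val (phi (nu v)) = - val (phi v).
  by rewrite /= cube_point_antipode normalizeN.
pose X' := range phi.
pose pt v : X' := exist (fun x => x \in X') _ (mem_set (imageT phi v)).
(* The enumeration of the vertices selects one vertex of each antipodal pair. *)
pose pos v := (enum_rank v < enum_rank (nu v))%N.
have nuK : involutive nu := @cube_antipodeK k N.
have posN v : pos (nu v) = ~~ pos v.
  rewrite /pos nuK -leqNgt ltn_neqAle;
    case: eqP => //= /val_inj/enum_rank_inj vv.
  case: (@cube_complex_antipodal k N N0 [set v] v).
    exact: (is_simplicial_complex_cube k N).1.
  by split=> //=; rewrite -/(nu v) vv.
pose beta v := if pos v then (pt v, true) else (pt (nu v), false).
have betaN v : beta (nu v) = antipode (beta v).
  by rewrite /beta posN; case: (pos v); rewrite /antipode/= ?nuK.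
exists X'; first exact: finite_image finite_finset.
exists (cube_vertex k N), (@cube_complex k N), nu, beta.
split=> //; first exact: cube_sphere.
have DeltaF F : cube_complex F -> Delta (restriction D X')
    (beta @` F).
  move=> QF; have [->|/set0P[u Fu]] := eqVneq F set0.
    by rewrite image_set0; exists (fun x => h0 (val x)) => //; exists h0.
  have [h Dh hu] := hD (phi u).
  exists (fun x => h (val x)); first by exists h.
  move=> _ [v Fv <-]; have uv := fine F u v QF Fu Fv.
  rewrite /beta; case: ifP => _ /=; first exact: (hu (phi v)).1.
  apply: (hu (phi (nu v))).2; rewrite phiN /geodesic_dist dotNl dotNr opprK.
  exact: uv.
move=> F QF; split; first exact: DeltaF.
have -> : @antipode X' @` (beta @` F) = beta @` (nu @` F).
  by rewrite !image_comp; apply: eq_imagel => v _ /=; rewrite betaN.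
exact/DeltaF/simplicial_map_cube_antipode.
Qed.

End fine_spheres.

(** * Reading off [sd_simp], empty domains, and the equivalence *)

(** The supremum may owe its size to a higher dimension only, hence the [j]. If no dimension from
    [k] on occurs, integrality bounds every element, the default -1 included, by k - 1. *)
Lemma sd_simp_ge (R : realType) (X : Type) (H : set (X -> bool)) (k : nat) :
  (k%:R%:E <= sd_simp R H)%E <->
  exists j, admits_simplicial_sphere R H (k + j)%N.
Proof.
split=> [ksd|[j kj]]; last first.
  apply: (@le_trans _ _ ((k + j)%:R%:E));
    first by rewrite lee_fin ler_nat leq_addr.
  by apply: ereal_sup_ubound; right; exists (k + j)%N.
apply: contrapT => /forallNP h.
have : (sd_simp R H <= (k%:R - 1)%:E)%E.
  apply: ge_ereal_sup => _ [->|[m Hm <-]]; rewrite lee_fin.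
    by have := ler0n R k; lra.
  have mk : (m < k)%N.
    by rewrite ltnNge; apply/negP => km; apply: (h (m - k)%N); rewrite subnKC.
  by have : m.+1%:R <= k%:R :> R; [rewrite ler_nat|rewrite -natr1; lra].
by move=> /(le_trans ksd); rewrite lee_fin; lra.
Qed.

Lemma VC_ge0 (R : realType) (X : Type) (H : set (X -> bool)) :
  H !=set0 -> (0 <= VC R H)%E.
Proof.
move=> [h Hh]; apply: ereal_sup_ubound; exists 0%N => //; exists set0;
  last by rewrite II0.
by move=> s; exists h.
Qed.

Section empty_domain.
Variables (R : realType) (X : Type) (H : set (X -> bool)).
Hypothesis X0 : X -> False.

Lemma VC_empty : (VC R H <= 0)%E.
Proof.
apply: ge_ereal_sup => _ [m [S _ Sm] <-].
by case: m Sm => // m /eq_cardSP[x]; case: (X0 x).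
Qed.

Lemma VCa_empty : VCa R H = -oo%E.
Proof.
rewrite /VCa [X in ereal_sup X](_ : _ = set0) ?ereal_sup0//.
apply/seteqP; split=> // y [m [G [_ /(_ (fun=> true))[x _]] _] _].
by case: (X0 x).
Qed.

End empty_domain.

Lemma Sphere_Negz (R : realType) (m : nat) : Sphere R (Negz m) -> False.
Proof.
move=> [u /set_mem]; rewrite /unit_sphere/= /dot big_ord0 => /eqP.
by rewrite eq_sym oner_eq0.
Qed.

Theorem theorem1p2 (R : realType) (a b n : int) :
  (exists (X : Type) (H : set (X -> bool)),
     [/\ H !=set0,
         (VC R H <= a%:~R%:E)%E,
         (VCa R H <= b%:~R%:E)%E
       & (n%:~R%:E <= sd_simp R H)%E])
  <->
  (exists D : set (Sphere R n -> bool),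
     [/\ D !=set0,
         disambiguates D,
         (VC R D <= a%:~R%:E)%E
       & (VCa R D <= b%:~R%:E)%E]).
Proof.
split=> [[X [H [H0 Ha Hb]]]|[D [D0 Ddis Da Db]]].
  case: n => [k|m] nsd.
    have [j /admits_sphere_disambiguates[c Hc]] := (sd_simp_ge R H k).1 nsd.
    exists (pullback c H); split=> //.
    - by have [h Hh] := H0; exists (fun v => h (c v).1 == (c v).2), h.
    - exact: le_trans (VC_pullback R c H) Ha.
    - exact: le_trans (VCa_pullback R c H) Hb.
  (* For negative n the sphere is empty: disambiguation is vacuous, [VCa] is -oo, and [VC] is at
     most 0, which is at most [a] because [H] is nonempty. *)
  exists setT; split; first by exists (fun=> true).
  - by exists 1 => // u; case: (Sphere_Negz u).
  - apply: le_trans (VC_empty R _ (@Sphere_Negz R m)) _.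
    exact: le_trans (VC_ge0 R H0) Ha.
  - by rewrite (VCa_empty R _ (@Sphere_Negz R m)) leNye.
exists (Sphere R n), D; split=> //.
case: n D D0 Ddis {Da Db} => [k|m] D D0 Ddis.
  by apply/(sd_simp_ge R D k); exists 0%N; rewrite addn0;
    exact: disambiguates_admits_sphere.
(* For negative n the default value -1 of [sd_simp] is already large enough. *)
apply: (@le_trans _ _ (-1)%:E); last by apply: ereal_sup_ubound; left.
by rewrite lee_fin NegzE mulrNz lerN2 ler1n.
Qed.
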